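(* Let $G$ be a finite group with generating set $\Sigma$ such that the Cayley graph $\mathrm{Cay}(G,\Sigma)$ is geodetic but neither a complete graph nor a cycle. Then $|\Sigma|<1.07\sqrt{|G|}$.
   Context: All generating sets $\Sigma\subseteq G$ satisfy $1\notin\Sigma$ and $\Sigma=\Sigma^{-1}$. The (undirected, simple) Cayley graph $\mathrm{Cay}(G,\Sigma)$ has vertex set $G$ and edge set $\{\{g,ga\} : g\in G,\ a\in\Sigma\}$. A connected graph is geodetic if for each pair of vertices there is a unique shortest path connecting them. *)

(* Defs.v *)
From mathcomp Require Import all_boot all_fingroup.

Set Implicit Arguments.
Unset Strict Implicit.
Unset Printing Implicit Defensive.

Local Open Scope group_scope.

(* A simple graph on a finite vertex type is given by its adjacency relation.
   Cayley edges are unordered pairs {x, x * a}; see cayleyE, cayley_sym and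
   cayley_irr for the relation obtained from an inverse-closed set S that
   does not contain 1. *)
Definition cayley (gT : finGroupType) (S : {set gT}) : rel gT :=
  fun g h => [exists x, exists a in S, [set g; h] == [set x; x * a]].

Section Graphs.
Variables (T : finType) (e : rel T).

(* As in mathcomp's path library, the path x :: p is represented by its first
   vertex x and the sequence p of the remaining ones; its length is size p. *)
Definition path_between (x y : T) (p : seq T) : bool :=
  [&& path e x p, uniq (x :: p) & last x p == y].

Definition shortest_path (x y : T) (p : seq T) : Prop :=
  path_between x y p /\ forall q, path_between x y q -> size p <= size q.

Definition connected_graph : Prop := forall x y, connect e x y.

Definition geodetic : Prop :=
  connected_graph /\ forall x y, exists! p, shortest_path x y p.

Definition complete_graph : Prop := forall x y, x != y -> e x y.

End Graphs.

Definition graph_iso (T U : finType) (e : rel T) (f : rel U) : Prop :=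
  exists2 h : T -> U, bijective h & {mono h : x y / e x y >-> f x y}.

(* ordS i is i + 1 mod n. *)
Definition cycle_rel (n : nat) : rel 'I_n :=
  fun i j => (j == ordS i) || (i == ordS j).

Definition cycle_graph (T : finType) (e : rel T) : Prop :=
  exists2 n : nat, 3 <= n & graph_iso e (@cycle_rel n).

Section CayleyFacts.
Variables (gT : finGroupType) (S : {set gT}).

Lemma cayley_sym : symmetric (cayley S).
Proof. by move=> g h; rewrite /cayley setUC. Qed.

Hypothesis S_inv : S^-1 = S.

Lemma cayleyE g h : cayley S g h = (g^-1 * h \in S).
Proof.
apply/existsP/idP => [[x /exists_inP[a Sa /eqP Egh]]|Sgh]; last first.
  by exists g; apply/exists_inP; exists (g^-1 * h); rewrite // mulKVg.
have gx : g \in [set x; x * a] by rewrite -Egh set21.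
have hx : h \in [set x; x * a] by rewrite -Egh set22.
have xg : x \in [set g; h] by rewrite Egh set21.
have ag : x * a \in [set g; h] by rewrite Egh set22.
have Sa' : a^-1 \in S by rewrite -S_inv mem_invg invgK.
have a1 : x * a = x -> 1 \in S.
  by move/(canRL (mulKg x)); rewrite mulVg => <-.
case/set2P: gx => Eg; case/set2P: hx => Eh; rewrite Eg Eh in xg ag *.
- by rewrite mulVg; apply: a1; case/set2P: ag.
- by rewrite mulKg.
- by rewrite invMg mulgKV.
- by rewrite mulVg; apply: a1; case/set2P: xg.
Qed.

Lemma cayley_irr : 1 \notin S -> irreflexive (cayley S).
Proof. by move=> S1 g; rewrite cayleyE mulVg (negbTE S1). Qed.

End CayleyFacts.

(* Main.v *)
(* Let d = |S| and n = |G|.  In a geodetic graph the neighbourhood of a vertex is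
   a disjoint union of cliques; let m of them, of sizes c_1, ..., c_m, occur at
   the vertex 1, put Q = c_1^2 + ... + c_m^2, and let f be the number of vertices
   at distance at least 3 from 1.  Vertices at distance 2 have a single midpoint,
   so n = 1 + d + (d^2 - Q) + f.

   Comparing the two ends of the paths of length 2 gives
   f >= sum_(i < j) c_i c_j |c_i - c_j| >= m Q - d^2, and f >= d unless f = 0,
   because a vertex at distance 3 has only one neighbour closer to 1.

   If some c_i = c is at least m, then cliques with c + 1 vertices cannot stay at
   distance 2 from 1, whence f >= (d - c) c^2 and n > d^2.  If all c_i are less
   than m and f > 0, the displayed estimates suffice.  If f = 0, all c_i are
   equal to some c, and the graph is strongly regular with mu = 1; the estimate
   then fails for five pairs (c, m) only, and there the multiplicities of the
   eigenvalues would not be integers. *)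
Require Import Defs.
From mathcomp Require Import all_boot all_order all_fingroup all_algebra.
From mathcomp Require Import all_field zify ring lra.

Set Implicit Arguments.
Unset Strict Implicit.
Unset Printing Implicit Defensive.

(** * Cliques and distance spheres in geodetic graphs *)

Section GeodeticGraph.

Variables (T : finType) (e : rel T).
Hypotheses (e_sym : symmetric e) (e_irr : irreflexive e).
Hypothesis e_geo : geodetic e.

Implicit Types x y z u v w : T.

Lemma edge_neq x y : e x y -> x != y.
Proof. by apply: contraTneq => ->; rewrite e_irr. Qed.

Definition nbhd x := [set y | e x y].
(** The vertex x is left out, so the sets [clq x y] with y adjacent to x partition [nbhd x]; the
    clique itself has one vertex more. *)
Definition clq x y := [set z in nbhd x | (y == z) || e y z].
Definition sphere2 x :=
  [set y | [&& x != y, ~~ e x y & [exists z, e x z && e z y]]].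
Definition far x :=
  [set y | [&& x != y, ~~ e x y & ~~ [exists z, e x z && e z y]]].

Lemma mid_unique x y a b : x != y -> ~~ e x y ->
  e x a -> e a y -> e x b -> e b y -> a = b.
Proof.
move=> xy exy.
suff sp c : e x c -> e c y -> shortest_path e x y [:: c; y].
  move=> xa ay xb bY; case: e_geo => _ /(_ x y)[p [_ pu]].
  by have := pu _ (sp _ xa ay); rewrite (pu _ (sp _ xb bY)) => -[->].
move=> xc cy; split.
  by rewrite /path_between /= !inE !negb_or xc cy xy !edge_neq /=.
case=> [|a1 [|a2 q]] //; rewrite /path_between /=.
  by rewrite (negbTE xy).
by case/and3P=> /andP[xa _] _ /eqP aE; rewrite aE (negbTE exy) in xa.
Qed.

(** A three-edge walk from x to a vertex of [far x] is a shortest path, so its last inner vertex is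
    determined. *)
Lemma far_path_unique x y a b a' b' : y \in far x ->
  e x a -> e a b -> e b y -> e x a' -> e a' b' -> e b' y -> b = b'.
Proof.
rewrite inE => /and3P[xy exy /existsPn nz].
suff sp c d : e x c -> e c d -> e d y -> shortest_path e x y [:: c; d; y].
  move=> xa ab bY xa' ab' bY'; case: e_geo => _ /(_ x y)[p [_ pu]].
  by have := pu _ (sp _ _ xa ab bY); rewrite (pu _ (sp _ _ xa' ab' bY')) => -[_ ->].
move=> xc cd dy; split.
  have xd : x != d by apply: contraNneq exy => ->.
  have cy : c != y by apply: contraNneq exy => <-.
  by rewrite /path_between /= !inE !negb_or xc cd dy xy xd cy !edge_neq /=.
case=> [|a1 [|a2 [|a3 q]]] //; rewrite /path_between /=.
- by rewrite (negbTE xy).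
- by case/and3P=> /andP[xa _] _ /eqP aE; rewrite aE (negbTE exy) in xa.
case/and3P=> /and3P[xa aa _] _ /eqP aE; rewrite aE in aa.
by have := nz a1; rewrite xa aa.
Qed.

Lemma in_clq x y z : (z \in clq x y) = e x z && ((y == z) || e y z).
Proof. by rewrite !inE. Qed.

Lemma clq_refl x y : e x y -> y \in clq x y.
Proof. by rewrite in_clq eqxx => ->. Qed.

Lemma clq_edge x y z : z \in clq x y -> e x z.
Proof. by rewrite in_clq => /andP[]. Qed.

Lemma clq_sym x y z : e x y -> z \in clq x y -> y \in clq x z.
Proof. by rewrite !in_clq eq_sym (e_sym y) => -> /andP[]. Qed.

(** If y and w were distinct and nonadjacent, the adjacent vertices x and z would both be midpoints
    between them. *)
Lemma clq_trans x y z w : e x y ->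
  z \in clq x y -> w \in clq x z -> w \in clq x y.
Proof.
rewrite !in_clq => xy /andP[xz yz] /andP[xw zw]; rewrite xw /=.
case/predU1P: yz => [-> //|yz]; case/predU1P: zw => [<-|zw].
  by rewrite yz orbT.
case: eqVneq => //= yw; apply: contraT => nyw; rewrite e_sym in xy.
by move: (xz); rewrite (mid_unique yw nyw xy xw yz zw) e_irr.
Qed.

Lemma clq_eq x y z : e x y -> z \in clq x y -> clq x z = clq x y.
Proof.
move=> xy yz; have xz := clq_edge yz; apply/setP => w.
by apply/idP/idP; apply: clq_trans => //; apply: clq_sym.
Qed.

Lemma card_clq x y : e x y -> #|clq x y| = #|nbhd x :&: nbhd y|.+1.
Proof.
move=> xy; have -> : clq x y = y |: (nbhd x :&: nbhd y).
  by apply/setP => z; rewrite !inE; case: (eqVneq z y) => [->|]; rewrite ?xy.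
by rewrite cardsU1 !inE e_irr andbF.
Qed.

Lemma card_clqC x y : e x y -> #|clq x y| = #|clq y x|.
Proof. by move=> xy; rewrite !card_clq ?(e_sym y) // setIC. Qed.

Lemma in_sphere2 x z y : e x z -> e z y ->
  (y \in sphere2 x) = (y \notin clq z x).
Proof.
move=> xz zy; rewrite !inE zy negb_or /= andbA.
have -> : [exists u, e x u && e u y] by apply/existsP; exists z; rewrite xz.
by rewrite andbT.
Qed.

(** Unique midpoints make the union over z disjoint. The weight f lets one decomposition count both
    the vertices at distance 2 and their neighbours in [far x]. *)
Lemma sum_sphere2 x (f : T -> nat) :
  \sum_(y in sphere2 x) f y
    = \sum_(z in nbhd x) \sum_(y in nbhd z :\: clq z x) f y.
Proof.
pose F z := if e x z then nbhd z :\: clq z x else set0.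
have FE : sphere2 x = \bigcup_z F z.
  apply/setP => y; apply/idP/bigcupP => [y2|[z _]].
    have:= y2; rewrite inE => /and3P[_ _ /existsP[z /andP[xz zy]]]; exists z => //.
    by rewrite /F xz in_setD -(in_sphere2 xz zy) y2 inE.
  rewrite /F; case: ifP => xz; rewrite ?in_set0 // in_setD => /andP[yN].
  by rewrite inE => zy; rewrite (in_sphere2 xz zy).
rewrite FE partition_disjoint_bigcup => [|z z' zz'].
  rewrite (bigID (mem (nbhd x))) /= [X in _ + X]big1 ?addn0 => [|z].
    by apply: eq_bigr => z; rewrite inE /F => ->.
  by rewrite inE /F => /negbTE ->; rewrite big_set0.
apply/pred0P => y; apply: contraNF zz' => /andP[/=].
rewrite /F; case: ifP => xz; rewrite ?inE // => /andP[+ zy].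
case: ifP => xz'; rewrite ?inE // => + /andP[_ z'y]; rewrite zy negb_or /=.
by case/andP=> xy nxy; apply/eqP; exact: (mid_unique xy nxy).
Qed.

Lemma card_sphere2 x :
  #|sphere2 x| = \sum_(z in nbhd x) (#|nbhd z| - #|clq z x|).
Proof.
rewrite -sum1_card sum_sphere2; apply: eq_bigr => z xz.
rewrite sum1_card cardsD (setIidPr _) //.
by apply/subsetP => y /clq_edge; rewrite inE.
Qed.

Lemma card_spheres x : #|T| = 1 + #|nbhd x| + #|sphere2 x| + #|far x|.
Proof.
have -> : 1 + #|nbhd x| = #|x |: nbhd x| by rewrite cardsU1 inE e_irr.
rewrite -(cardsC (x |: nbhd x)) -addnA; congr (_ + _).
rewrite -cardsUI [_ :&: _](_ : _ = set0) ?cards0 ?addn0.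
  congr #|pred_of_set _|; apply/setP => y; rewrite !inE negb_or eq_sym.
  by case: (x == y); case: (e x y); case: [exists _, _].
by apply/setP=> y; rewrite !inE; case: [exists _, _]; rewrite !andbF.
Qed.

(** The sets counted are disjoint, since the last inner vertex of a three-edge path into [far x] is
    unique. *)
Lemma sum_far_le x :
  \sum_(y in sphere2 x) #|nbhd y :&: far x| <= #|far x|.
Proof.
pose F y := if y \in sphere2 x then nbhd y :&: far x else set0.
have disF y y' : y != y' -> [disjoint F y & F y'].
  move=> yy'; apply/pred0P => u; apply: contraNF yy' => /andP[/=].
  rewrite /F; case: ifP => y2; last by rewrite inE.
  rewrite !inE in y2; rewrite in_setI => /andP[+ uF]; rewrite inE => yu.
  case: ifP => y2'; last by rewrite inE.
  rewrite !inE in y2'; rewrite in_setI => /andP[+ _]; rewrite inE => y'u.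
  case/and3P: y2 => _ _ /existsP[a /andP[xa ay]].
  case/and3P: y2' => _ _ /existsP[b /andP[xb bY]].
  by rewrite (far_path_unique uF xa ay yu xb bY y'u).
have -> : \sum_(y in sphere2 x) #|nbhd y :&: far x| = #|\bigcup_y F y|.
  rewrite -sum1_card partition_disjoint_bigcup //.
  rewrite [RHS](bigID (mem (sphere2 x))) /= [X in _ + X]big1 ?addn0 => [|y].
    by apply: eq_bigr => y y2; rewrite sum1_card /F y2.
  by rewrite /F => /negbTE ->; rewrite big_set0.
apply/subset_leq_card/bigcupsP => y _; rewrite /F.
by case: ifP; rewrite ?sub0set // subsetIr.
Qed.

(** If u were adjacent to x, it would be a midpoint between x and y, hence equal to z, which lies in
    [clq y z]. *)
Lemma nbhd_sphere2_far x z y u :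
  e x z -> e z y -> y \in sphere2 x -> e y u -> u \notin clq y z ->
  (u \in sphere2 x) || (u \in far x).
Proof.
move=> xz zy y2 yu uN.
suff [xu nxu] : x != u /\ ~~ e x u.
  by rewrite !inE xu nxu /=; case: [exists _, _].
move: y2; rewrite inE => /and3P[xy nxy _].
split; first by apply: contraNneq nxy => ->; rewrite e_sym.
apply: contra uN => xu; rewrite e_sym in yu.
by rewrite (mid_unique xy nxy xz zy xu yu) clq_refl // e_sym.
Qed.

(* Off the cliques of the path x - z - y, the neighbours of y at distance 2 from
   x inject into the neighbours of x. *)
Lemma far_clq_diff x z y : #|nbhd x| = #|nbhd y| -> e x z -> e z y ->
  y \in sphere2 x -> #|clq x z| - #|clq y z| <= #|nbhd y :&: far x|.
Proof.
move=> dxy xz zy y2.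
have /and3P[xy nxy _] : [&& x != y, ~~ e x y & [exists z, e x z && e z y]].
  by move: y2; rewrite inE.
have zx : e z x by rewrite e_sym.
have yz : e y z by rewrite e_sym.
pose B := (nbhd y :\: clq y z) :\: far x.
have BP u : u \in B -> [/\ e y u, u \notin clq y z & u \in sphere2 x].
  rewrite !in_setD => /and3P[uF uN]; rewrite inE => yu; split => //.
  by have := nbhd_sphere2_far xz zy y2 yu uN; rewrite (negbTE uF) orbF.
(* The midpoint between x and u; the default x is never taken on B. *)
pose mu u := odflt x [pick a | e x a && e a u].
have muP u : u \in B -> e x (mu u) /\ e (mu u) u.
  move=> /BP[_ _]; rewrite inE => /and3P[_ _ /existsP[a xa]].
  by rewrite /mu; case: pickP => [b /andP[]|/(_ a)] //=; rewrite xa.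
have zu u : u \in B -> z != u /\ ~~ e z u.
  case/BP=> yu uN _; apply/andP; rewrite -negb_or.
  by move: uN; rewrite in_clq yu.
have mu_z u : u \in B -> mu u != z.
  move=> uB; have [xm mu_u] := muP _ uB; have [_ nzu] := zu _ uB.
  by apply: contraNneq nzu => <-.
have mu_in : mu @: B \subset nbhd x :\: clq x z.
  apply/subsetP => _ /imsetP[u uB ->].
  have [xm mu_u] := muP _ uB; have [yu uN _] := BP _ uB.
  rewrite in_setD in_clq inE xm eq_sym negb_or mu_z //= andbT.
  have [zu' nzu] := zu _ uB; apply/negP => zm.
  have yE := mid_unique zu' nzu zm mu_u zy yu.
  by move: nxy; rewrite -yE xm.
(* Two vertices of B with the same midpoint would both be midpoints between y and that vertex. *)
have mu_inj : {in B &, injective mu}.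
  move=> u u' uB u'B muE; have [xm mu_u] := muP _ uB.
  have [_ mu_u'] := muP _ u'B; have [yu _ _] := BP _ uB.
  have [yu' _ _] := BP _ u'B; rewrite -muE in mu_u'.
  have ym : y != mu u by apply: contraNneq nxy => ->.
  have nym : ~~ e y (mu u).
    apply: contra (mu_z _ uB) => ym'; apply/eqP.
    by apply: (mid_unique xy nxy) => //; rewrite e_sym.
  by apply: (mid_unique ym nym) => //; rewrite e_sym.
have := subset_leq_card mu_in; rewrite card_in_imset //.
have clq_sub a b : clq a b \subset nbhd a.
  by apply/subsetP => w /clq_edge; rewrite inE.
rewrite /B cardsD !cardsD.
rewrite (setIidPr (clq_sub x z)) (setIidPr (clq_sub y z)).
have : #|(nbhd y :\: clq y z) :&: far x| <= #|nbhd y :&: far x|.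
  by apply: subset_leq_card; apply: setSI; apply: subsetDl.
have := subset_leq_card (clq_sub x z); have := subset_leq_card (clq_sub y z).
by rewrite dxy; lia.
Qed.

(** Apart from y, all neighbours of u lie in [far x], and u itself makes up for y. *)
Lemma card_nbhd_far x y u :
  y \in sphere2 x -> e y u -> u \in far x -> #|nbhd u| <= #|far x|.
Proof.
move=> y2 yu uF.
have yN : y \in nbhd u by rewrite inE e_sym.
have uN : u \notin nbhd u :\ y by rewrite !inE e_irr andbF.
have -> : #|nbhd u| = #|u |: nbhd u :\ y| by rewrite cardsU1 uN (cardsD1 y) yN.
apply/subset_leq_card/subsetP => w; rewrite 2!inE => /predU1P[-> //|].
rewrite inE => /andP[wy]; rewrite inE => uw.
move: (uF) (y2); rewrite !inE.
case/and3P=> xu nxu /existsPn nz /and3P[_ _ /existsP[z /andP[xz zy]]].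
have xw : x != w by apply: contraNneq nxu => ->; rewrite e_sym.
have nxw : ~~ e x w.
  by apply/negP => xw'; have := nz w; rewrite xw' e_sym uw.
rewrite xw nxw /=; apply: contra wy => /existsP[a /andP[xa aw]].
by rewrite e_sym in uw; rewrite (far_path_unique uF xa aw uw xz zy yu) set11.
Qed.

(* A clique all of whose vertices are at distance 2 from x has at most as many
   vertices as there are cliques through x, since the midpoints lie in distinct
   ones.  So a clique with more vertices that meets the sphere of radius 2 in y,
   and is not the clique containing the geodesic's last edge, leaves it. *)
Lemma big_clq_far x z y v : e x z -> e z y -> y \in sphere2 x -> e y v ->
  z \notin clq y v -> #|clq x @: nbhd x| <= #|clq y v| -> clq y v \subset far x.
Proof.
move=> xz zy y2 yv zN; apply: contraLR => /subsetPn[w wv wF]; rewrite -ltnNge.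
have yz : e y z by rewrite e_sym.
have L_off u : u \in clq y v -> u \notin clq y z.
  move=> uv; apply: contra zN => uz.
  by rewrite -(clq_eq yv uv) (clq_eq yz uz) clq_refl.
have w2 : w \in sphere2 x.
  have := nbhd_sphere2_far xz zy y2 (clq_edge wv) (L_off _ wv).
  by rewrite (negbTE wF) orbF.
have L_adj u u' : u \in y |: clq y v -> u' \in y |: clq y v -> u != u' -> e u u'.
  case/setU1P=> [->|uv] /setU1P[->|u'v]; rewrite ?eqxx //.
  - by rewrite (clq_edge u'v).
  - by rewrite e_sym (clq_edge uv).
  by have := u'v; rewrite -(clq_eq yv uv) in_clq => /andP[_ /predU1P[->|//]];
    rewrite eqxx.
(* If u were in [far x], then y and w would both be last inner vertices of shortest paths from x to
   u. *)
have L2 u : u \in y |: clq y v -> u \in sphere2 x.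
  case/setU1P=> [-> //|uv].
  have := nbhd_sphere2_far xz zy y2 (clq_edge uv) (L_off _ uv).
  case/orP=> // uF; have [wu|wu] := eqVneq w u; first by rewrite -wu.
  have ewu : e w u by apply: L_adj; rewrite ?in_setU ?uv ?wv ?orbT.
  have := w2; rewrite inE => /and3P[_ _ /existsP[a /andP[xa aw]]].
  have yw := far_path_unique uF xz zy (clq_edge uv) xa aw ewu.
  by have := clq_edge wv; rewrite yw e_irr.
have L_nbhd u : u \in y |: clq y v -> ~~ e x u.
  by move=> /L2; rewrite inE => /and3P[].
(* A vertex a adjacent to two members of the clique belongs to it, but no member is adjacent to
   x. *)
have L_max u u' a : u \in y |: clq y v -> u' \in y |: clq y v -> u != u' ->
    e x a -> e a u -> e a u' -> False.
  move=> uL u'L uu' xa au au'.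
  have aL : a \notin y |: clq y v by apply: contraL xa; apply: L_nbhd.
  have clq_a b : b \in clq y v -> e a b -> e a y -> False.
    move=> bv ab ay; move: aL; rewrite in_setU1 negb_or => /andP[_].
    by rewrite -(clq_eq yv bv) in_clq e_sym ay e_sym ab orbT.
  case/setU1P: (uL) => [uy|uv].
    case/setU1P: (u'L) => [u'y|u'v]; first by rewrite uy u'y eqxx in uu'.
    by apply: (clq_a _ u'v au'); rewrite -uy.
  case/setU1P: (u'L) => [u'y|u'v]; first by apply: (clq_a _ uv au); rewrite -u'y.
  apply: (clq_a _ uv au); apply: contraT => nay.
  have ay : a != y by move: aL; rewrite in_setU1 negb_or => /andP[].
  case/eqP: uu'; apply: (mid_unique ay nay) => //; rewrite e_sym.
    exact: clq_edge uv.
  exact: clq_edge u'v.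
pose mu u := odflt x [pick a | e x a && e a u].
have muP u : u \in y |: clq y v -> e x (mu u) /\ e (mu u) u.
  move=> /L2; rewrite inE => /and3P[_ _ /existsP[a xa]].
  by rewrite /mu; case: pickP => [b /andP[]|/(_ a)] //=; rewrite xa.
have <- : #|[set clq x (mu u) | u in y |: clq y v]| = #|clq y v|.+1.
  rewrite card_in_imset => [|u u' uL u'L /= clqE].
    by rewrite cardsU1 in_clq e_irr.
  have [xa au] := muP _ uL; have [xb bu'] := muP _ u'L.
  have [//|uu'] := eqVneq u u'; exfalso.
  have := clq_refl xb; rewrite -clqE in_clq => /andP[_ /predU1P[abE|ab]].
    by apply: (L_max _ _ _ uL u'L uu' xa); rewrite // abE.
  (* Adjacent midpoints are excluded as well: [mu u] and u' would both be midpoints between u and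
     [mu u']. *)
  have au' : mu u != u' by apply: contraTneq xa => ->; apply: L_nbhd.
  have ub : u != mu u' by apply: contraTneq xb => <-; apply: L_nbhd.
  have nub : ~~ e u (mu u').
    by apply/negP => eub; apply: (L_max _ _ _ uL u'L uu' xb); rewrite // e_sym.
  case/eqP: au'; apply: (mid_unique ub nub) => //; rewrite ?(L_adj u u') //;
  by rewrite e_sym.
apply/subset_leq_card/subsetP => _ /imsetP[u /muP[xa _] ->].
by apply: imset_f; rewrite inE.
Qed.

(** * Sums over the cliques at a vertex *)

Lemma sum_clqs x (f : T -> nat) :
  \sum_(z in nbhd x) f z = \sum_(B in clq x @: nbhd x) \sum_(z in B) f z.
Proof.
rewrite (partition_big_imset (clq x)) /=; apply: eq_bigr => B /imsetP[y].
rewrite inE => xy ->; apply: eq_bigl => z; rewrite inE.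
apply/andP/idP => [[xz /eqP <-]|zy]; first exact: clq_refl.
by rewrite (clq_edge zy) (clq_eq xy zy).
Qed.

Lemma card_nbhd_clqs x : #|nbhd x| = \sum_(B in clq x @: nbhd x) #|B|.
Proof.
by rewrite -sum1_card sum_clqs; apply: eq_bigr => B _; rewrite sum1_card.
Qed.

(** For each of the m cliques B, Q is at most d |B| plus the truncated differences between the
    clique sizes at the neighbours z and |B|; these bounds are summed over B. *)
Lemma clqs_sum_le x :
  #|clq x @: nbhd x| * (\sum_(z in nbhd x) #|clq x z|)
    <= #|nbhd x| ^ 2
       + \sum_(w in nbhd x) \sum_(z in nbhd x) (#|clq x z| - #|clq x w|).
Proof.
set P := clq x @: _; set Q := (X in _ * X).
pose D k := \sum_(z in nbhd x) (#|clq x z| - k).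
apply: (@leq_trans (\sum_(B in P) (#|nbhd x| * #|B| + D #|B|))).
  rewrite -sum_nat_const; apply: leq_sum => B _.
  rewrite /D -sum_nat_const -big_split /=; apply: leq_sum => z _; lia.
rewrite big_split /= -big_distrr /= -card_nbhd_clqs leq_add2l.
rewrite (sum_clqs x (fun w => D #|clq x w|)).
apply: leq_sum => B /imsetP[y]; rewrite inE => xy ->.
by rewrite (big_setD1 y) ?clq_refl //= leq_addr.
Qed.

Lemma card_nbhd_le_far x (d : nat) :
  (forall y, #|nbhd y| = d) -> far x != set0 -> d <= #|far x| /\ sphere2 x != set0.
Proof.
move=> deg /set0Pn[u uF].
suff [y [w [y2 yw wF]]] : exists y w, [/\ y \in sphere2 x, e y w & w \in far x].
  split; last by apply/set0Pn; exists y.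
  by rewrite -(deg w); apply: card_nbhd_far y2 yw wF.
have [/existsP[y /exists_inP[w]]|noyw] :=
    boolP [exists y, exists w in far x, (y \in sphere2 x) && e y w].
  by move=> wF /andP[y2 yw]; exists y, w.
(* Without an edge from [sphere2 x] to [far x], the complement of [far x] is closed under adjacency,
   against connectedness. *)
have cl : closed e (mem (~: far x)).
  apply: (intro_closed (sym_connect_sym e_sym)) => y w yw; rewrite !in_setC.
  apply: contra => wF; rewrite !inE.
  have := wF; rewrite inE => /and3P[xw nxw /existsPn nz].
  have -> : x != y by apply: contraNneq nxw => ->.
  have -> /= : ~~ e x y by apply: contraNN (nz y) => ->.
  apply: contra noyw => ez; apply/existsP; exists y; apply/exists_inP; exists w => //.
  rewrite yw andbT !inE ez andbT; apply/andP; split.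
    by apply: contraNneq nxw => ->.
  by apply: contraNN (nz y) => ->.
have := closed_connect cl ((proj1 e_geo) x u).
by rewrite !in_setC uF inE eqxx.
Qed.

End GeodeticGraph.

(** * Eigenvalue multiplicities of strongly regular graphs with mu = 1 *)

Section StronglyRegular.

Local Open Scope ring_scope.
Import GRing.Theory Num.Theory.

(** Write P = C W with C of full column rank and W of full row rank. Cancelling in C W C W = C W
    gives W C = 1, and C W and W C have the same trace. *)
Lemma mxtrace_idem (F : fieldType) n (P : 'M[F]_n) :
  P *m P = P -> \tr P = (\rank P)%:R.
Proof.
move=> PP; rewrite -{1}[P]mulmx_base mxtrace_mulC.
suff -> : row_base P *m col_base P = 1%:M by rewrite mxtrace1.
have /row_fullP[L LC] := col_base_full P.
have /row_freeP[U RU] := row_base_free P.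
move: LC RU (mulmx_base P).
move: (col_base P) (row_base P) => C W LC WU PE.
have : (L *m C) *m (W *m C) *m (W *m U) = (L *m C) *m (W *m U).
  by rewrite -!mulmxA (mulmxA C W (C *m _)) (mulmxA C W U) PE
    (mulmxA P) PP.
by rewrite LC WU !mul1mx mulmx1.
Qed.

(* On the complement of the constant vectors the adjacency matrix has the two
   eigenvalues t and t + r, where r^2 is the discriminant; f is the multiplicity
   of t + r, the trace of the corresponding projection. *)
Lemma srg_mu1_discriminant (T : finType) (e : rel T) (x0 : T) (d l : nat) :
  symmetric e -> irreflexive e -> (1 < d)%N ->
  (forall x y, #|[set z | e x z && e z y]|
     = if x == y then d else if e x y then l else 1%N) ->
  exists f : nat, ((l%:Z - 1) ^+ 2 + 4 * (d%:Z - 1)) * (#|T|%:Z - 1 - 2 * f%:Z) ^+ 2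
    = ((#|T|%:Z - 1) * (l%:Z - 1) + 2 * d%:Z) ^+ 2.
Proof.
move=> e_sym e_irr d2 count; pose n := #|T|.
have n0 : (0 < n)%N by apply/card_gt0P; exists x0.
pose A : 'M[algC]_n := \matrix_(i, j) (e (enum_val i) (enum_val j))%:R.
pose J : 'M[algC]_n := const_mx 1.
have sum_ev (f : T -> algC) : \sum_(i < n) f (enum_val i) = \sum_x f x.
  by rewrite [RHS](big_enum_val (A := T)).
have deg x : \sum_y (e x y)%:R = d%:R :> algC.
  rewrite -natr_sum -big_mkcond sum1_card /=; congr _%:R.
  by have := count x x; rewrite eqxx => <-; apply: eq_card => y;
    rewrite !inE /= (e_sym y) andbb.
have AA : A *m A = (l%:R - 1) *: A + (d%:R - 1) *: 1%:M + J.
  apply/matrixP => i j; rewrite !mxE.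
  under eq_bigr => k _ do rewrite !mxE -natrM mulnb.
  rewrite (sum_ev (fun z => (e (enum_val i) z && e z (enum_val j))%:R)).
  rewrite -natr_sum -big_mkcond sum1_card /=.
  have -> : #|[pred z | e (enum_val i) z && e z (enum_val j)]|
    = #|[set z | e (enum_val i) z && e z (enum_val j)]|.
    by apply: eq_card => z; rewrite inE.
  rewrite count (inj_eq enum_val_inj); case: (eqVneq i j) => [->|ij].
    by rewrite e_irr /=; ring.
  by case: (e _ _) => /=; ring.
have AJ : A *m J = d%:R *: J.
  apply/matrixP => i j; rewrite !mxE mulr1 -(deg (enum_val i)) -sum_ev.
  by apply: eq_bigr => k _; rewrite !mxE mulr1.
have JA : J *m A = d%:R *: J.
  apply/matrixP => i j; rewrite !mxE mulr1 -(deg (enum_val j)) -sum_ev.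
  by apply: eq_bigr => k _; rewrite !mxE mul1r e_sym.
have JJ : J *m J = n%:R *: J.
  apply/matrixP => i j; rewrite !mxE mulr1.
  by under eq_bigr do rewrite !mxE mulr1; rewrite sumr_const card_ord.
pose D : algC := (l%:R - 1) ^+ 2 + 4 * (d%:R - 1).
have D_neq0 : D != 0.
  have -> : D = ((l%:Z - 1) ^+ 2 + 4 * (d%:Z - 1))%:~R.
    by rewrite /D !(rmorphD, rmorphB, rmorphM, rmorphXn) /= ?natz.
  by rewrite intr_eq0; apply: lt0r_neq0; nia.
pose r := sqrtC D; have rr : r ^+ 2 = D by apply: sqrtCK.
have r0 : r != 0 by rewrite sqrtC_eq0.
(* Both t and t + r are roots of X^2 - (l - 1) X - (d - 1). *)
pose t := ((l%:R - 1) - r) / 2.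
have th_t : (t + r) + t = l%:R - 1 by rewrite /t; field.
have th_m : (t + r) * t = - (d%:R - 1).
  have -> : (t + r) * t = ((l%:R - 1) ^+ 2 - r ^+ 2) / 4 by rewrite /t; field.
  by rewrite rr /D; field.
(* The row sums of A^2 are computed in two ways. *)
have nE : (d%:R - t) * (d%:R - (t + r)) = n%:R.
  have /matrixP/(_ (enum_rank x0) (enum_rank x0)) : A *m A *m J = A *m (A *m J).
    by rewrite mulmxA.
  rewrite AA AJ -scalemxAr AJ !mulmxDl -!scalemxAl AJ mul1mx JJ !mxE !mulr1.
  by move/(canRL (addKr _)) ->; rewrite -th_t -[_ - 1]opprK -th_m; ring.
have n0' : n%:R != 0 :> algC by rewrite pnatr_eq0 -lt0n.
(* This b makes M vanish on constant vectors; on vectors of sum zero M acts as A - t, so M is r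
   times a projection. *)
pose b := (d%:R - t) / n%:R.
pose M := A - t *: 1%:M - b *: J.
have bn : b * n%:R = d%:R - t by rewrite /b divfK.
have bd : b * (d%:R - (t + r)) = 1.
  by rewrite /b mulrAC nE divff.
have MM : M *m M = r *: M.
  rewrite /M !mulmxBl !mulmxBr -!scalemxAl -!scalemxAr !mul1mx !mulmx1 AA AJ JA JJ.
  rewrite -th_t -[d%:R - 1]opprK -th_m.
  apply/matrixP => i j; rewrite !mxE.
  move: ((e _ _)%:R) ((i == j)%:R) => a dl.
  have -> : b * (b * (n%:R * 1)) = b * (d%:R - t) by rewrite mulr1 bn.
  have -> : r * (a - t * dl - b * 1) = r * (a - t * dl) - b * (d%:R - t)
     + b * (d%:R - (t + r)) by ring.
  by rewrite bd; ring.
have trM : \tr M = - t * n%:R - (d%:R - t).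
  rewrite /M !raddfB /= !mxtraceZ mxtrace1.
  have -> : \tr A = 0 by rewrite /mxtrace big1 // => i _; rewrite mxE e_irr.
  have -> : \tr J = n%:R.
    by rewrite /mxtrace; under eq_bigr do rewrite mxE; rewrite sumr_const card_ord.
  by rewrite bn; ring.
have PP : (r^-1 *: M) *m (r^-1 *: M) = r^-1 *: M.
  by rewrite -scalemxAl -scalemxAr MM !scalerA -mulrA mulVf // mulr1.
have := mxtrace_idem PP; rewrite mxtraceZ trM; set f := (\rank _)%N => trf.
(* The trace equation is solved for f; squaring it will remove the root r. *)
have key : r * (n%:R - 1 - 2 * f%:R) = (n%:R - 1) * (l%:R - 1) + 2 * d%:R.
  rewrite -trf.
  have -> : r * (n%:R - 1 - 2 * (r^-1 * (- t * n%:R - (d%:R - t))))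
    = r * (n%:R - 1) - 2 * (r * r^-1) * (- t * n%:R - (d%:R - t)) by ring.
  rewrite divff //.
  have -> : r = l%:R - 1 - 2 * t by rewrite /t; field.
  by ring.
exists f; apply: (intr_inj (R := algC)).
rewrite !(rmorphD, rmorphB, rmorphM, rmorphXn, rmorph1, rmorph_nat, rmorphN) /=.
rewrite -!pmulrn.
by rewrite -/n -expr2 -key exprMn rr.
Qed.

End StronglyRegular.

(** * Numerical estimates *)

Section Arithmetic.

(** In use, c is the largest clique size, c + a the degree, and q and f count the vertices at
    distance 2 and at least 3. *)
Lemma large_clique_bound m c a q f :
  0 < a -> m <= c -> c + a <= m * c -> 2 * (a * c) <= q -> a * c ^ 2 <= f ->
  100 ^ 2 * (c + a) ^ 2 < 107 ^ 2 * (1 + (c + a) + q + f).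
Proof.
move=> a0 mc dmc qle fle.
suff : (c + a) ^ 2 <= 1 + (c + a) + q + f by lia.
have mcc : m * c <= c * c by rewrite leq_mul2r mc orbT.
(* The two sides differ by (a - 1)(c^2 - a), and a <= c^2 because c + a <= m c <= c^2. *)
have key : c ^ 2 + a ^ 2 <= a + a * c ^ 2.
  have ac : a <= c ^ 2 by lia.
  by case: a a0 ac {dmc qle fle mcc} => // a _; move: (c ^ 2) => k; nia.
by lia.
Qed.

(** Multiplying n by m lets the bound on m Q eliminate Q; then f >= d and d <= m (m - 1) leave an
    inequality in m and d. *)
Lemma small_clique_far_bound m d k Q f n :
  0 < m -> k < m -> d <= m * k -> Q <= d ^ 2 -> m * Q <= d ^ 2 + f -> d <= f ->
  n = 1 + d + (d ^ 2 - Q) + f -> 100 ^ 2 * d ^ 2 < 107 ^ 2 * n.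
Proof.
move=> m0 km dmk Qd mQ df nE.
have mn : m * n >= m + m * d + (m - 1) * d ^ 2 + (m - 1) * f.
  by rewrite nE; nia.
have mn' : m * n >= m + m * d + (m - 1) * d ^ 2 + (m - 1) * d by nia.
have dd : d ^ 2 <= m * (m - 1) * d.
  rewrite -mulnn leq_mul2r; apply/orP; right.
  by apply: leq_trans dmk _; rewrite leq_mul2l; apply/orP; right; lia.
rewrite -(ltn_pmul2l m0) mulnCA [m * (107 ^ 2 * n)]mulnCA.
move: (m * n) (d ^ 2) mn' dd {mn nE mQ Qd dmk km k df} => N D.
(* For m >= 8 the term in d^2 suffices, as 8 * 100^2 < 7 * 107^2; smaller m need the lower-order
   terms. *)
have [m8|m8] := leqP 8 m.
  move=> mn _; have : 7 * (m * D) <= 8 * ((m - 1) * D).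
    by rewrite !mulnA leq_mul2r; apply/orP; right; lia.
  by move: ((m - 1) * D) (m * D) ((m - 1) * d) (m * d) mn; lia.
by case: m m0 m8 => [|[|[|[|[|[|[|[|//]]]]]]]] // _ _; lia.
Qed.

Lemma sqr_int_gap (a : nat) (x : int) :
  (x * x <= a%:Z * a%:Z)%R \/ ((a%:Z + 1) * (a%:Z + 1) <= x * x)%R.
Proof.
have [xa|xa] : (`|x| <= Posz a)%R \/ (Posz a + 1 <= `|x|)%R by lia.
  by left; nia.
by right; nia.
Qed.

(** Here all cliques have size k, so Q = d k, and adjacent vertices have k - 1 common neighbours; f
    is an eigenvalue multiplicity. *)
Lemma diameter2_bound m k d n f : 0 < k -> k < m -> d = m * k ->
  n = 1 + d + (d ^ 2 - d * k) ->
  ((((k - 1)%N%:Z - 1) ^+ 2 + 4 * (d%:Z - 1)) * (n%:Z - 1 - 2 * f%:Z) ^+ 2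
    = ((n%:Z - 1) * ((k - 1)%N%:Z - 1) + 2 * d%:Z) ^+ 2)%R ->
  (100 * d) ^ 2 < 107 ^ 2 * n.
Proof.
move=> k0 km dE nE.
have nE' : n + d * k = 1 + d + d ^ 2 by rewrite nE; nia.
(* Since d k = d^2 / m, the case m >= 8 has n > (7/8) d^2. *)
have [m8|m8] := leqP 8 m.
  move=> _; rewrite expnMn; move: nE'; rewrite {1 2}dE; nia.
move: m8 km dE nE'; rewrite {}nE.
case: m => [|[|[|[|[|[|[|[|//]]]]]]]] // _;
  case: k k0 => [|[|[|[|[|[|[|//]]]]]]] // _ _ -> _.
(* Left are (m, k) = (3, 2), (4, 3), (5, 3), (5, 4), (6, 5). *)
all: try (by move=> _; lia).
all: move: (_ - 2 * _)%R => x; rewrite (GRing.expr2 x).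
(* For (5, 4) and (6, 5) the equation gives x^2 = 6480, between 80^2 and 81^2, and x^2 = 46080,
   between 214^2 and 215^2. For the other pairs x^2 would not be an integer. *)
all: have := sqr_int_gap 80 x; have := sqr_int_gap 214 x.
all: move: (x * x)%R => y; lia.
Qed.

End Arithmetic.

(** * Counting in geodetic Cayley graphs by translation *)

Section GeodeticCayley.

Variables (gT : finGroupType) (S : {set gT}).
Hypotheses (S1 : 1%g \notin S) (S_inv : (S^-1)%g = S).
Hypothesis S_geodetic : geodetic (cayley S).

Implicit Types g h s t x y z : gT.

Local Notation e := (cayley S).
Local Notation nbhd := (nbhd e).
Local Notation clq := (clq e).
Local Notation sphere2 := (sphere2 e).
Local Notation far := (far e).
Local Notation e_sym := (@cayley_sym gT S).
Local Notation e_irr := (cayley_irr S_inv S1).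
Local Notation c s := #|clq 1%g s|.

Lemma cayleyM g x y : e (g * x)%g (g * y)%g = e x y.
Proof. by rewrite !cayleyE // invMg mulgA mulgKV. Qed.

Lemma nbhd1 : nbhd 1%g = S.
Proof. by apply/setP => s; rewrite inE cayleyE // invg1 mul1g. Qed.

Lemma mem_invS s : (s^-1 \in S)%g = (s \in S).
Proof. by rewrite -{1}S_inv mem_invg invgK. Qed.

Lemma edge1 s : e 1%g s = (s \in S).
Proof. by rewrite cayleyE // invg1 mul1g. Qed.

Lemma nbhdM g : nbhd g = (g *: S)%g.
Proof. by apply/setP => h; rewrite inE cayleyE // mem_lcoset. Qed.

Lemma card_nbhdE g : #|nbhd g| = #|S|.
Proof. by rewrite nbhdM card_lcoset. Qed.

Lemma mem_clqM g x y z : (g * z \in clq (g * x) (g * y))%g = (z \in clq x y).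
Proof. by rewrite !in_clq !cayleyM (inj_eq (mulgI g)). Qed.

Lemma card_clqM g x y : #|clq (g * x)%g (g * y)%g| = #|clq x y|.
Proof.
have -> : clq (g * x)%g (g * y)%g = (g *: clq x y)%g.
  by apply/setP => z; rewrite mem_lcoset -{1}(mulKVg g z) mem_clqM.
exact: card_lcoset.
Qed.

Lemma card_clqE g s : #|clq g (g * s)%g| = c s.
Proof. by rewrite -{1}(mulg1 g) card_clqM. Qed.

Lemma card_clqV s : s \in S -> c (s^-1)%g = c s.
Proof.
move=> sS; rewrite -(card_clqE s (s^-1)%g) mulgV.
by rewrite (card_clqC e_sym e_irr) // e_sym edge1.
Qed.

Lemma sum_nbhd g (f : gT -> nat) :
  \sum_(y in nbhd g) f y = \sum_(t in S) f (g * t)%g.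
Proof.
rewrite nbhdM -lcosetE big_imset //= => t u _ _; exact: mulgI.
Qed.

(** The edges of the path 1, s, st lie in cliques of sizes c s and c t, so st has at least c s - c t
    neighbours in [far 1]. If st is not at distance 2, the two cliques agree and the difference is
    0. *)
Lemma card_far_clq_diff :
  \sum_(t in S) \sum_(s in S) (c s - c t) <= #|far 1%g|.
Proof.
apply: leq_trans (sum_far_le e_irr S_geodetic 1%g).
rewrite (sum_sphere2 e_irr S_geodetic) exchange_big nbhd1.
apply: leq_sum => s sS; have es1 : e s 1%g by rewrite e_sym edge1.
rewrite -[leqLHS](eq_bigr _ (fun t _ => congr1 (subn _) (card_clqE s t))).
rewrite -(sum_nbhd s (fun y => c s - #|clq s y|)).
rewrite (bigID (mem (clq s 1%g))) /= big1 => [|y /andP[_ y1]]; last first.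
  by rewrite (clq_eq e_sym e_irr S_geodetic es1 y1) (card_clqC e_sym e_irr es1) subnn.
rewrite add0n; under eq_bigl => y do rewrite andbC -in_setD.
apply: leq_sum => y /setDP[+ y1]; rewrite inE => esy.
rewrite (card_clqC e_sym e_irr esy).
have e1s : e 1%g s by rewrite edge1.
apply: (far_clq_diff e_sym e_irr S_geodetic _ e1s esy); first by rewrite !card_nbhdE.
by rewrite (in_sphere2 e1s esy).
Qed.

(** Summing c s over S gives Q, so the third term is d^2 - Q. *)
Lemma card_cayley :
  #|gT| = 1 + #|S| + \sum_(s in S) (#|S| - c s) + #|far 1%g|.
Proof.
rewrite (card_spheres e_irr 1%g) (card_sphere2 e_irr S_geodetic) nbhd1.
congr (_ + _ + _); apply: eq_bigr => s sS; rewrite card_nbhdE.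
by rewrite (card_clqC e_sym e_irr) // e_sym edge1.
Qed.

Lemma clq_subS s : clq 1%g s \subset S.
Proof. by apply/subsetP => t /clq_edge; rewrite edge1. Qed.

Lemma card_clq_le s : c s <= #|S|.
Proof. exact: subset_leq_card (clq_subS s). Qed.

Lemma card_clq_disjoint s t : s \in S -> t \in S -> t \notin clq 1%g s ->
  c s + c t <= #|S|.
Proof.
rewrite -!edge1 => es et ts; rewrite -cardsUI.
have -> : clq 1%g s :&: clq 1%g t = set0.
  apply/eqP; rewrite -subset0; apply/subsetP => u; rewrite inE => /andP[us ut].
  move: ts; rewrite -(clq_eq e_sym e_irr S_geodetic es us).
  by rewrite (clq_eq e_sym e_irr S_geodetic et ut) clq_refl.
by rewrite cards0 addn0 subset_leq_card // subUset !clq_subS.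
Qed.

Lemma card_far_big_clq s0 : s0 \in S -> #|clq 1%g @: S| <= c s0 ->
  (#|S| - c s0) * c s0 ^ 2 <= #|far 1%g|.
Proof.
move=> s0S ms0; apply: leq_trans (sum_far_le e_irr S_geodetic 1%g).
rewrite (sum_sphere2 e_irr S_geodetic) nbhd1.
(* For y = zt, the second condition puts y at distance 2 from 1; the first keeps z off the clique
   through y and y s0, which then lies in [far 1] apart from y. *)
pose b z t := (t^-1 \notin clq 1 s0)%g && (z^-1 \notin clq 1 t)%g.
apply: (@leq_trans (\sum_(z in S) \sum_(t in S) b z t * c s0)).
  rewrite exchange_big /=.
  have -> : (#|S| - c s0) * c s0 ^ 2
    = \sum_(t in S | t^-1%g \notin clq 1%g s0) c s0 ^ 2.
    rewrite sum_nat_const; congr (_ * _).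
    have <- : #|S :\: clq 1%g s0| = #|S| - c s0.
      by rewrite cardsD (setIidPr (clq_subS s0)).
    rewrite -(card_imset _ invg_inj); apply: eq_card => t.
    rewrite -[t]invgK (mem_imset _ _ invg_inj) invgK in_setD andbC.
    by rewrite mem_invS unfold_in.
  rewrite [leqRHS](bigID (fun t => t^-1 \notin clq 1 s0)%g) /=.
  apply: leq_trans (leq_addr _ _); apply: leq_sum => t /andP[tS ts0].
  rewrite -big_distrl /= -mulnn leq_mul2r; apply/orP; right.
  (* For fixed t there are d - c t choices of z, at least c s0 because the cliques of t^-1 and s0
     are disjoint. *)
  have <- : #|S :\: clq 1%g t| = \sum_(z in S) b z t.
    rewrite -(card_imset _ invg_inj) -sum1_card big_mkcond [RHS]big_mkcond /=.
    apply: eq_bigr => z _; rewrite -{1}[z]invgK (mem_imset _ _ invg_inj).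
    by rewrite in_setD mem_invS /b ts0; case: (z \in S); case: (_ \in _).
  rewrite cardsD (setIidPr (clq_subS t)) leq_subRL ?card_clq_le // addnC.
  rewrite -(card_clqV tS); apply: card_clq_disjoint => //.
  by rewrite mem_invS.
apply: leq_sum => z zS.
have z1 : e 1%g z by rewrite edge1.
have -> : \sum_(t in S) b z t * c s0
    = \sum_(y in nbhd z) b z (z^-1 * y)%g * c s0.
  by rewrite sum_nbhd; apply: eq_bigr => t _; rewrite mulKg.
rewrite [leqRHS](eq_bigl (fun y => (y \in nbhd z) && (y \notin clq z 1%g))); last first.
  by move=> y; rewrite in_setD andbC.
rewrite (bigID (mem (clq z 1%g))) /= big1 => [|y /andP[yz y1]]; last first.
  suff -> : b z (z^-1 * y)%g = false by [].
  apply/negbTE; rewrite negb_and; apply/orP; right; rewrite negbK.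
  have zy : e 1%g (z^-1 * y)%g by rewrite -(mulVg z) cayleyM; rewrite inE in yz.
  apply: (clq_sym e_sym); first by rewrite edge1 mem_invS.
  by rewrite -(mem_clqM z) mulgV mulg1 mulKVg.
rewrite add0n; apply: leq_sum => y /andP[+ y1]; rewrite inE => ezy.
case: (boolP (b _ _)) => // /andP[].
rewrite mul1n invMg invgK => ts0 _.
have es0 : e y (y * s0)%g by rewrite -{1}(mulg1 y) cayleyM edge1.
rewrite -(card_clqE y s0); apply: subset_leq_card.
rewrite subsetI; apply/andP; split.
  by apply/subsetP => v /clq_edge; rewrite inE.
apply: (big_clq_far e_sym e_irr S_geodetic z1 ezy) => //.
- by rewrite (in_sphere2 z1 ezy).
- by have := mem_clqM y 1%g s0 (y^-1 * z)%g; rewrite mulKVg mulg1 => ->.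
by rewrite nbhd1 card_clqE.
Qed.

Lemma clq_gt0 s : s \in S -> 0 < c s.
Proof.
by move=> sS; apply/card_gt0P; exists s; rewrite clq_refl // edge1.
Qed.

Lemma far_eq0 : sphere2 1%g = set0 -> far 1%g = set0.
Proof.
move=> s20; apply/eqP; apply: contraT.
case/(card_nbhd_le_far e_sym e_irr S_geodetic card_nbhdE).
by rewrite s20 eqxx.
Qed.

Lemma sphere2_complete : sphere2 1%g = set0 -> complete_graph e.
Proof.
move=> s20 x y xy; rewrite cayleyE //; apply: contraT => xyS.
have := far_eq0 s20 => /setP/(_ (x^-1 * y)%g).
have := s20 => /setP/(_ (x^-1 * y)%g).
rewrite !inE edge1 xyS -(inj_eq (mulgI x)) mulg1 mulKVg xy /=.
by case: [exists _, _].
Qed.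

Lemma clq_proper s : ~ complete_graph e -> s \in S -> c s < #|S|.
Proof.
move=> ncomp sS; rewrite ltn_neqAle card_clq_le // andbT.
apply: contra_notN ncomp => /eqP cs; apply: sphere2_complete.
apply/eqP; rewrite -cards_eq0 (card_sphere2 e_irr S_geodetic) nbhd1 //.
apply/eqP; apply: big1 => t tS; rewrite card_nbhdE // (card_clqC e_sym e_irr); last first.
  by rewrite e_sym edge1.
have clqS : clq 1%g s = S.
  by apply/eqP; rewrite eqEcard clq_subS // cs leqnn.
have es : e 1%g s by rewrite edge1.
have ts : t \in clq 1%g s by rewrite clqS.
by rewrite (clq_eq e_sym e_irr S_geodetic es ts) clqS subnn.
Qed.

(** The value k - 1 arises because [clq] also contains the other endpoint of the edge. *)
Lemma common_nbhd_card k x y : far 1%g = set0 -> (forall s, s \in S -> c s = k) ->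
  #|[set z | e x z && e z y]| = if x == y then #|S| else if e x y then k - 1 else 1.
Proof.
move=> far0 ck; have cap : [set z | e x z && e z y] = nbhd x :&: nbhd y.
  by apply/setP => z; rewrite !inE (e_sym y).
case: eqVneq => [->|xy].
  rewrite -(card_nbhdE y); apply: eq_card => z.
  by rewrite !inE (e_sym z) andbb.
case: ifP => [exy|nxy].
  have := ck (x^-1 * y)%g; rewrite -cayleyE // => /(_ exy) <-.
  rewrite -(card_clqE x) mulKVg cap (card_clq e_irr exy).
  by rewrite subn1.
have /setP/(_ (x^-1 * y)%g) := far0; rewrite !inE.
rewrite -[_ == _](inj_eq (mulgI x)) -(cayleyM x 1%g) mulKVg mulg1 xy nxy /=.
move/negbFE/existsP=> [z /andP[xz zy]].
rewrite -(cayleyM x) mulg1 in xz; rewrite -(cayleyM x) mulKVg in zy.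
apply/eqP/cards1P; exists (x * z)%g; apply/setP => w; rewrite !inE.
apply/andP/eqP => [[xw wy]|-> //].
by apply: (mid_unique e_irr S_geodetic xy (negbT nxy)).
Qed.

Lemma card_cayley_bound : ~ complete_graph e -> (100 * #|S|) ^ 2 < 107 ^ 2 * #|gT|.
Proof.
move=> ncomp; have nE := card_cayley.
have [S0|[s sS]] := set_0Vmem S; first by rewrite nE S0 cards0; lia.
have [s0 s0S cmax] : exists2 s0, s0 \in S & forall s, s \in S -> c s <= c s0.
  by case: (arg_maxnP (fun s => c s) sS) => s0; exists s0.
clear s sS.
have cd := clq_proper ncomp s0S; have c0 := clq_gt0 s0S.
pose m := #|clq 1%g @: S|.
have dE : #|S| = \sum_(B in clq 1%g @: S) #|B|.
  have := card_nbhd_clqs e_sym e_irr S_geodetic 1%g; rewrite nbhd1 //.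
have dm : #|S| <= m * c s0.
  rewrite dE -sum_nat_const; apply: leq_sum => B /imsetP[s sS ->].
  exact: cmax.
have QE : \sum_(s in S) (#|S| - c s) + \sum_(s in S) c s = #|S| ^ 2.
  rewrite -big_split /= -mulnn -sum_nat_const; apply: eq_bigr => s sS.
  by rewrite subnK // card_clq_le.
have UF := card_far_clq_diff.
have mQ := clqs_sum_le e_sym e_irr S_geodetic 1%g; rewrite nbhd1 // -/m in mQ.
have [mc|cm] := leqP m (c s0).
  have F := card_far_big_clq s0S mc.
  (* Inside the largest clique each term is at least d - c s0; outside it, disjointness makes each
     term at least c s0. *)
  have Q2 : 2 * ((#|S| - c s0) * c s0) <= \sum_(s in S) (#|S| - c s).
    rewrite (bigID (mem (clq 1%g s0))) /= mul2n -addnn; apply: leq_add.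
      rewrite mulnC -sum_nat_const [leqRHS](eq_bigl (mem (clq 1%g s0))).
        apply: leq_sum => s ss; rewrite leq_sub2l // cmax //.
        exact: subsetP (clq_subS s0) s ss.
      by move=> s; rewrite andb_idl // => ss; have := subsetP (clq_subS s0) s ss.
    have <- : #|S :\: clq 1%g s0| = #|S| - c s0.
      by rewrite cardsD (setIidPr (clq_subS s0)).
    rewrite -sum_nat_const [leqRHS](eq_bigl (fun s => s \in S :\: clq 1%g s0)).
      apply: leq_sum => s /setDP[sS sN].
      rewrite leq_subRL ?card_clq_le // addnC.
      exact: (card_clq_disjoint s0S sS sN).
    by move=> s; rewrite in_setD andbC.
  rewrite nE -{1 2}(subnKC (ltnW cd)) expnMn.
  apply: large_clique_bound mc _ Q2 F; rewrite ?subn_gt0 //.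
  by rewrite subnKC // ltnW.
have QE' : \sum_(s in S) (#|S| - c s) = #|S| ^ 2 - \sum_(s in S) c s by lia.
have [F0|F0] := posnP #|far 1%g|.
  (* With no vertices in [far 1], every truncated difference of clique sizes is 0. *)
  have cE s : s \in S -> c s = c s0.
    move=> sS; apply/eqP; rewrite eqn_leq cmax //=.
    rewrite F0 leqn0 in UF; move: UF; rewrite sum_nat_eq0 => /forall_inP/(_ s sS).
    by rewrite sum_nat_eq0 => /forall_inP/(_ s0 s0S); rewrite subn_eq0.
  have dE' : #|S| = m * c s0.
    by rewrite dE -sum_nat_const; apply: eq_bigr => B /imsetP[s sS ->]; apply: cE.
  have far0 : far 1%g = set0 by apply/eqP; rewrite -cards_eq0 F0.
  have d2 : 1 < #|S| by lia.
  have [f fE] := srg_mu1_discriminant 1%g e_sym e_irr d2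
    (fun x y => common_nbhd_card x y far0 cE).
  apply: diameter2_bound c0 cm dE' _ fE.
  by rewrite nE F0 addn0 QE' (eq_bigr _ cE) sum_nat_const.
have [] := card_nbhd_le_far e_sym e_irr S_geodetic card_nbhdE (x := 1%g).
  by rewrite -cards_eq0 -lt0n.
move=> dF _; rewrite QE' in nE; rewrite expnMn.
apply: (small_clique_far_bound _ cm dm _ _ dF nE); first exact: leq_ltn_trans cm.
  by rewrite -QE leq_addl.
by apply: leq_trans mQ _; rewrite leq_add2l.
Qed.

End GeodeticCayley.

Import GRing.Theory Num.Theory.

Theorem theorem4 (R : rcfType) (gT : finGroupType) (S : {set gT})
    (S1 : 1%g \notin S) (S_inv : (S^-1)%g = S) (S_gen : <<S>>%g = [set: gT])
    (S_geodetic : geodetic (cayley S))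
    (S_not_complete : ~ complete_graph (cayley S))
    (S_not_cycle : ~ cycle_graph (cayley S)) :
  (#|S|%:R < 107%:R / 100%:R * Num.sqrt (#|[set: gT]|%:R) :> R)%R.
Proof.
have bound := card_cayley_bound S1 S_inv S_geodetic S_not_complete.
(* Both sides are nonnegative, so squaring reduces the claim to the integer bound. *)
rewrite -(ltr_pXn2r (n := 2)) ?nnegrE ?mulr_ge0 ?invr_ge0 ?sqrtr_ge0 ?ler0n //.
rewrite exprMn sqr_sqrtr ?ler0n // cardsT.
move: bound; rewrite -(ltr_nat R) natrM !natrX natrM => bound.
lra.
Qed.
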